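(* Let $n\ge1$ and $k\in\{1,\dots,n\}$, and write the coordinates on $\mathbb{C}^n$ as $(z,w)$ with $z=x+iy\in\mathbb{C}^k$, $w=u+iv\in\mathbb{C}^{n-k}$. Let $A$ and $B$ be real symmetric matrices of dimension $k$ and $n-k$ respectively, with $A>I$ (i.e. $A-I$ positive definite) and $B>0$ (i.e. $B$ positive definite), and set $$Q(y,w)=\langle Ay,y\rangle+\langle Bv,v\rangle+|u|^2,\qquad \rho(z,w)=Q(y,w)-|x|^2.$$ Let $\Lambda^k=\{(x+i0,0)\in\mathbb{C}^n: x\in\mathbb{R}^k\}$. Given $r>0$ and $\epsilon>0$, there exist constants $0<r<c_0<R$ and $\delta>0$, and a smooth, increasing, weakly convex function $h\colon[0,+\infty)\to[0,+\infty)$ such that $$\tau(z,w):=Q(y,w)-h(|x|^2)$$ is a strongly plurisubharmonic function on $\mathbb{C}^n$, with a Morse critical point of index $k$ at $0\in\mathbb{C}^n$, satisfying (i) for $|x|^2\le r$ we have $\tau(z,w)=Q(y,w)-\delta|x|^2$; (ii) for $|x|^2\ge R$ we have $\tau(z,w)=\rho(z,w)+c_0$; (iii) $\{\rho\le-c_0\}\cup\Lambda^k\subset\{\tau\le0\}\subset\{\rho<-r\}\cup\{Q<\epsilon\}$.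
   Context: $\langle\cdot,\cdot\rangle$ is the Euclidean inner product and $|\cdot|$ the Euclidean norm on any $\mathbb{R}^m$. A $C^2$ function $\phi$ on an open set $V\subset\mathbb{C}^n$ is strongly plurisubharmonic if its Levi form $\sum_{j,k=1}^n\frac{\partial^2\phi}{\partial\zeta_j\partial\bar\zeta_k}(\zeta)\,v_j\bar v_k$ is $>0$ for all $\zeta\in V$ and $v\in\mathbb{C}^n\setminus\{0\}$. Sets such as $\{\rho<-r\}$, $\{Q<\epsilon\}$ denote sublevel sets in $\mathbb{C}^n$, with $Q$ regarded as a function of $(z,w)$. If $k=n$, the variable $w$ and the matrix $B$ are absent. *)

(* Defs.v *)
From HB Require Import structures.
From mathcomp Require Import all_boot all_order all_algebra.
From mathcomp Require Import all_classical all_reals all_analysis.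
From mathcomp.real_closed Require Export complex.
Set Implicit Arguments.
Unset Strict Implicit.
Unset Printing Implicit Defensive.
Import Order.TTheory GRing.Theory Num.Theory.
Import numFieldNormedType.Exports.
Local Open Scope classical_set_scope.
Local Open Scope ring_scope.
Local Open Scope complex_scope.

(* The usual topology on the complex numbers, so that 'cV[R[i]]_n carries the
   product topology. *)
HB.instance Definition _ (R : rcfType) := NormedModule.copy R[i] (R[i])^o.

Section RealLinearAlgebra.
Variable R : realType.

Definition dotp n (u v : 'cV[R]_n) : R := \sum_(i < n) u i 0 * v i 0.

Definition sqnorm n (u : 'cV[R]_n) : R := dotp u u.

Definition posdef n (M : 'M[R]_n) : Prop :=
  forall v : 'cV[R]_n, v != 0 -> 0 < dotp (M *m v) v.

Definition negdef_on N (H U : 'M[R]_N) : Prop :=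
  forall v : 'rV[R]_N, (v <= U)%MS -> v != 0 -> (v *m H *m v^T) 0 0 < 0.

(* The largest dimension of a subspace on which the form H is negative
   definite; subspaces are row spaces of square matrices. *)
Definition has_index N (H : 'M[R]_N) (k : nat) : Prop :=
  (exists2 U : 'M[R]_N, negdef_on H U & \rank U = k) /\
  (forall U : 'M[R]_N, negdef_on H U -> (\rank U <= k)%N).

End RealLinearAlgebra.

Section Calculus.
Variables (R : realType) (n : nat).
Notation Cn := 'cV[R[i]]_n.

(* The 2n real coordinate directions of C^n: e_j for lshift n j and i e_j for
   rshift n j. *)
Definition real_dir (a : 'I_(n + n)) : Cn :=
  match fintype.split a with
  | inl j => delta_mx j 0
  | inr j => 'i *: delta_mx j 0
  end.

Definition line (f : Cn -> R) (p : Cn) (a : 'I_(n + n)) : R -> R :=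
  fun t => f (p + t%:C *: real_dir a).

Definition has_partial (f : Cn -> R) (a : 'I_(n + n)) (p : Cn) : Prop :=
  derivable (line f p a) 0 1.

Definition partial (a : 'I_(n + n)) (f : Cn -> R) : Cn -> R :=
  fun p => derive1 (line f p a) 0.

Definition C2_on (V : set Cn) (f : Cn -> R) : Prop :=
  forall p, V p ->
    {for p, continuous f} /\
    forall a, [/\ has_partial f a p,
                  {for p, continuous (partial a f)} &
      forall b, has_partial (partial a f) b p /\
                {for p, continuous (partial b (partial a f))}].

Definition cpartial (a : 'I_(n + n)) (F : Cn -> R[i]) : Cn -> R[i] :=
  fun p => partial a (fun q => complex.Re (F q)) p
       +i* partial a (fun q => complex.Im (F q)) p.

(* Wirtinger operators d/dzeta_j = (d/dx_j - i d/dy_j) / 2 and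
   d/dzetabar_j = (d/dx_j + i d/dy_j) / 2, where zeta_j = x_j + i y_j. *)
Definition dz (j : 'I_n) (F : Cn -> R[i]) : Cn -> R[i] :=
  fun p => (cpartial (lshift n j) F p - 'i * cpartial (rshift n j) F p) / 2.

Definition dzbar (j : 'I_n) (F : Cn -> R[i]) : Cn -> R[i] :=
  fun p => (cpartial (lshift n j) F p + 'i * cpartial (rshift n j) F p) / 2.

Definition levi (f : Cn -> R) (p v : Cn) : R[i] :=
  \sum_(j < n) \sum_(k < n)
    dz j (dzbar k (fun q => (f q)%:C)) p * v j 0 * (v k 0)^*.

(* In the order of R[i], 0 < x means that x is real and positive. *)
Definition strongly_psh (V : set Cn) (f : Cn -> R) : Prop :=
  C2_on V f /\ forall p, V p -> forall v : Cn, v != 0 -> 0 < levi f p v.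

Definition hessian (f : Cn -> R) (p : Cn) : 'M[R]_(n + n) :=
  \matrix_(a, b) partial a (partial b f) p.

Definition morse_critical_point (f : Cn -> R) (p : Cn) (k : nat) : Prop :=
  [/\ exists V : set Cn, [/\ open V, V p & C2_on V f],
      forall a, partial a f p = 0,
      hessian f p \in unitmx &
      has_index (hessian f p) k].

End Calculus.

Section HalfLine.
Variable R : realType.

Definition smooth_on_open (U : set R) (g : R -> R) : Prop :=
  forall (m : nat) (x : R), U x -> derivable (derive1n m g) x 1.

(* Smoothness on an arbitrary subset D of the line: near each point of D, the
   function agrees on D with a smooth function on an open set. *)
Definition smooth_on (D : set R) (h : R -> R) : Prop :=
  forall x, D x -> exists (U : set R) (g : R -> R),
    [/\ open U, U x, smooth_on_open U g &
        forall y, U y -> D y -> g y = h y].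

End HalfLine.

Section Quadric.
(* C^(k + m) has coordinates (z, w) = (x + iy, u + iv), with z the first k
   entries and w the last m. *)
Variables (R : realType) (k m : nat).
Notation Cn := 'cV[R[i]]_(k + m).

Definition xpart (p : Cn) : 'cV[R]_k := map_mx (@complex.Re R) (usubmx p).
Definition ypart (p : Cn) : 'cV[R]_k := map_mx (@complex.Im R) (usubmx p).
Definition upart (p : Cn) : 'cV[R]_m := map_mx (@complex.Re R) (dsubmx p).
Definition vpart (p : Cn) : 'cV[R]_m := map_mx (@complex.Im R) (dsubmx p).

Definition Qfun (A : 'M[R]_k) (B : 'M[R]_m) (p : Cn) : R :=
  dotp (A *m ypart p) (ypart p) + dotp (B *m vpart p) (vpart p)
  + sqnorm (upart p).

Definition rho (A : 'M[R]_k) (B : 'M[R]_m) (p : Cn) : R :=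
  Qfun A B p - sqnorm (xpart p).

Definition tau (A : 'M[R]_k) (B : 'M[R]_m) (h : R -> R) (p : Cn) : R :=
  Qfun A B p - h (sqnorm (xpart p)).

Definition Lambda : set Cn :=
  [set col_mx (map_mx (fun t : R => t%:C) x) (0 : 'cV[R[i]]_m)
     | x in [set: 'cV[R]_k]].

End Quadric.
Arguments Lambda : clear implicits.

(* Main.v *)
Require Import Defs.
From mathcomp Require Import all_boot all_order all_algebra.
From mathcomp Require Import all_classical all_reals all_analysis.
From mathcomp Require Import ring lra.
Import Order.TTheory GRing.Theory Num.Theory.
Import numFieldNormedType.Exports.
Local Open Scope classical_set_scope.
Local Open Scope ring_scope.
Set Implicit Arguments.
Unset Strict Implicit.
Unset Printing Implicit Defensive.

(** The function Q - h(|x|^2) splits into a quadratic form in the y, u, v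
    variables and a function of x, so its Levi form is explicit: up to a factor
    it is the sum of the forms of A - h'I - 2h'' x x^T, B and I, where h' and
    h'' are taken at t = |x|^2.  By the Cauchy-Schwarz inequality
    (x.s)^2 <= |x|^2 |s|^2 it is positive as soon as A >= lam I and

      h'(t) + 2 t h''(t) < lam    for all t >= 0.

    As A - I is positive definite, some lam > 1 is available
    ([posdef_coercive]).  The problem is thus to find a convex h of one
    variable, equal to delta t for small t and to t - c0 for large t, with this
    bound.  Since lam - 1 > 0 may be tiny, the slope has to climb from delta to
    1 with t h''(t) small; this is possible because dt/t has infinite integral
    at infinity: spreading the climb over a long enough interval [a, b] makes
    t h'' as small as desired ([slow_step]).  Concretely h'' is a multiple of
    exp(-1/((t - a)(b - t))) / t, which is smooth on (0, oo) and vanishes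
    outside ]a, b[, and h is obtained by integrating twice ([profile]).

    The inclusions between sublevel sets only use the graph of h.  Since
    h' <= 1, the function t - h(t) increases up to its final value c0, so
    h(t) >= t - c0; this gives the first inclusion.  For the second, a = 2r: on [0, a] one has
    h <= delta a < eps, and beyond a one has t - h(t) >= a(1 - delta) > r.

    On C^n, all functions are expressed through the vector of 2n real
    coordinates: Q and |x|^2 are quadratic forms with matrices [Qmx] and
    [Xmx], so first and second partial derivatives come from the chain rule
    ([has_pderiv_tau], [has_pderiv_tau1]).  The Levi form is recovered from the
    real Hessian H by the identity 4 L(v) = H(v, v) + H(iv, iv) ([leviE]).  At
    the origin the Hessian is 2 Qmx - 2 delta Xmx, which is negative definite
    on the x-space and positive definite on its complement ([morse_tau]). *)

(** * Smooth functions of one real variable *)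

Section Smoothness.
Variable R : realType.
Implicit Types (f g : R -> R) (U : set R) (m : nat).

(** Differentiability m times on U, the successive derivatives being witnessed
    by explicit functions: the closure properties then follow by induction on m
    from the rules for first derivatives, without any formula for the m-th
    derivative of a product or of a composition. *)
Fixpoint diffn m U f : Prop :=
  if m is m'.+1 then
    exists2 f', forall x, U x -> is_derive x 1 f (f' x) & diffn m' U f'
  else True.

Definition smooth U f := forall m, diffn m U f.

Lemma is_derive_open U f g x l : open U -> U x ->
  (forall y, U y -> f y = g y) -> is_derive x 1 f l -> is_derive x 1 g l.
Proof.
move=> oU Ux fg; apply: near_eq_is_derive.
by apply: filterS (open_nbhs_nbhs (conj oU Ux)) => y /fg.
Qed.

Lemma eq_diffn m U f g : open U -> (forall y, U y -> f y = g y) ->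
  diffn m U f -> diffn m U g.
Proof.
move=> oU fg; case: m => // m [f' df sf'] /=; exists f' => // x Ux.
exact: is_derive_open oU Ux fg (df x Ux).
Qed.

Lemma smooth_onP U f : open U -> smooth U f -> smooth_on_open U f.
Proof.
move=> oU sf m x Ux; have := sf m.+1; elim: m f {sf} => [|m IH] f.
  by case=> f' df _; apply: ex_derive; exact: df.
case=> f' df sf'; rewrite derive1Sn; apply: IH.
apply: (@eq_diffn m.+1 U f') => // y Uy.
by rewrite derive1E; have := df y Uy => dfy; rewrite derive_val.
Qed.

Lemma diffnW m U f : diffn m.+1 U f -> diffn m U f.
Proof.
elim: m f => // m IH f [f' df sf']; exists f' => //; exact: IH.
Qed.

Lemma diffn_cst m U (c : R) : diffn m U (fun=> c).
Proof.
elim: m c => // m IH c; exists (fun=> 0) => // x _; exact: is_derive_cst.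
Qed.

Lemma diffn_id m U : diffn m U id.
Proof.
case: m => // m; exists (fun=> 1); last exact: diffn_cst.
by move=> x _; exact: is_derive_id.
Qed.

Lemma diffnD m U f g : diffn m U f -> diffn m U g ->
  diffn m U (fun x => f x + g x).
Proof.
elim: m f g => // m IH f g [f' df sf] [g' dg sg].
exists (fun x => f' x + g' x); last exact: IH.
by move=> x Ux; have := is_deriveD (df x Ux) (dg x Ux).
Qed.

Lemma diffnM m U f g : diffn m U f -> diffn m U g ->
  diffn m U (fun x => f x * g x).
Proof.
elim: m f g => // m IH f g sf sg.
have [f' df sf'] := sf; have [g' dg sg'] := sg.
exists (fun x => f x * g' x + g x * f' x).
  by move=> x Ux; have := is_deriveM (df x Ux) (dg x Ux).
by apply: diffnD; apply: IH => //; exact: diffnW.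
Qed.

Lemma diffn_comp m U V f g : (forall x, U x -> V (g x)) ->
  diffn m V f -> diffn m U g -> diffn m U (f \o g).
Proof.
move=> gUV; elim: m f g gUV => // m IH f g gUV sf sg.
have [f' df sf'] := sf; have [g' dg sg'] := sg.
exists (fun x => (f' \o g) x * g' x).
  by move=> x Ux; have := is_derive1_comp (df _ (gUV _ Ux)) (dg x Ux).
by apply: diffnM => //; apply: IH => //; exact: diffnW.
Qed.

(** The derivative of c / x^j is again of this form, which makes the induction
    go through for the whole family at once. *)
Lemma diffn_inv m U : (forall x, U x -> x != 0) -> diffn m U (fun x => x^-1).
Proof.
move=> U0; suff H c j : diffn m U (fun x => c * (x^-1) ^+ j).
  have /= := H 1 1%N; congr diffn.
  by apply/funext => x; rewrite mul1r expr1.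
elim: m c j => // m IH c j.
exists (fun x => - (c * j%:R) * (x^-1) ^+ j.+1) => // x Ux.
have d1 := is_deriveV (U0 x Ux) (is_derive_id x (1:R)).
have d2 := is_deriveZ c (is_deriveX j d1).
have -> : (fun x => c * x^-1 ^+ j) = c \*: ((fun y : R => (id y)^-1) ^+ j).
  by apply/funext => y; rewrite /GRing.scale_fun exprfctE.
apply: (is_derive_eq d2).
rewrite /GRing.scale /= mulr1 exprVn -!exprVn.
case: j {d2} => [|j] /=; first by rewrite !(mulr0, mul0r, oppr0).
by rewrite !exprS; ring.
Qed.

Lemma smooth_primitive U f g : (forall x, U x -> is_derive x 1 f (g x)) ->
  smooth U g -> smooth U f.
Proof. by move=> df sg [|m] //; exists g. Qed.

Lemma is_derive_continuous f (x l : R) : is_derive x 1 f l -> {for x, continuous f}.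
Proof.
move=> df; apply: differentiable_continuous; apply/derivable1_diffP.
exact: ex_derive.
Qed.

End Smoothness.

(** * A smooth function that is flat at the origin *)

Section FlatFunction.
Variable R : realType.
Implicit Types (x : R) (j m : nat).

(** The factor x^-j is there because the family, unlike its member exp(-1/x), is
    closed under differentiation up to linear combinations. *)
Definition flat j x : R := if 0 < x then x^-1 ^+ j * expR (- x^-1) else 0.

Lemma flat_ge0 j x : 0 <= flat j x.
Proof.
rewrite /flat; case: ifP => // x0.
by rewrite mulr_ge0 ?expR_ge0// exprn_ge0// invr_ge0 ltW.
Qed.

Lemma flat_npos j x : x <= 0 -> flat j x = 0.
Proof. by rewrite /flat leNgt => /negbTE ->. Qed.

(** From exp(1/x) >= (1/x)^(j+1) / (j+1)!. *)
Lemma flat_le j x : 0 <= x -> flat j x <= j.+1`!%:R * x.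
Proof.
move=> x0; rewrite /flat; case: ifP => [xp|_]; last by rewrite mulr_ge0.
have xn0 : x != 0 by rewrite gt_eqF.
have fpos : (0 : R) < j.+1`!%:R by rewrite ltr0n fact_gt0.
have := @expR_ge1Dxn R x^-1 j; rewrite invr_ge0 => /(_ x0) H.
rewrite expRN ler_pdivrMr ?expR_gt0//.
apply: (@le_trans _ _ (j.+1`!%:R * x * (x^-1 ^+ j.+1 / j.+1`!%:R))); last first.
  by rewrite ler_pM2l ?mulr_gt0//; apply: le_trans H; rewrite lerDr.
rewrite le_eqVlt; apply/orP; left; apply/eqP.
rewrite exprS; field.
by rewrite xn0 gt_eqF.
Qed.

(** At the origin the difference quotient of [flat j] is [flat j.+1], which tends
    to 0 by [flat_le]. *)
Lemma is_derive_flat j x :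
  is_derive x 1 (flat j) (- j%:R * flat j.+1 x + flat j.+2 x).
Proof.
have [x0|x0|x0] := ltgtP x 0.
- rewrite !flat_npos ?ltW// mulr0 addr0.
  apply: (@is_derive_open _ [set t | t < 0] (fun=> 0)) => //.
    by move=> y /= y0; rewrite flat_npos// ltW.
- have xn0 : x != 0 by rewrite gt_eqF.
  apply: (@is_derive_open _ [set t | 0 < t]
    (fun t => t^-1 ^+ j * expR (- t^-1))) => //.
    by move=> y /= y0; rewrite /flat y0.
  have d1 := is_deriveV xn0 (is_derive_id x (1:R)).
  have d2 := is_deriveX j d1.
  have d3 := is_derive1_comp (is_derive_expR _) (is_deriveN d1).
  have d4 := is_deriveM d2 d3.
  have -> : (fun t : R => t^-1 ^+ j * expR (- t^-1)) =
     ((fun y : R => (id y)^-1) ^+ j) * (expR \o (- (fun y : R => (id y)^-1))).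
    by apply/funext => y; rewrite mulrfctE exprfctE.
  apply: (is_derive_eq d4).
  rewrite /flat x0 /GRing.scale /= !exprfctE /=.
  rewrite opprfctE /=.
  case: j {d2 d4} => [|j] /=; first by rewrite !exprS expr0; field.
  by rewrite !exprS; field.
- rewrite x0 !flat_npos// mulr0 addr0.
  have H : (fun h : R => h^-1 *: ((flat j \o shift 0) (h *: 1) - flat j 0))
     @ 0^' --> (0 : R).
    apply/cvgr0Pnorm_le => e e0.
    have fpos : (0 : R) < j.+2`!%:R by rewrite ltr0n fact_gt0.
    near=> h.
    rewrite /= addr0 [flat j 0]flat_npos// subr0 /GRing.scale /= mulr1.
    have hle : `|h| <= e / j.+2`!%:R.
      by near: h; apply: dnbhs0_le; rewrite divr_gt0.
    have [h0|h0] := leP h 0.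
      by rewrite flat_npos// mulr0 normr0 ltW.
    have -> : h^-1 * flat j h = flat j.+1 h by rewrite /flat h0 exprS mulrA.
    rewrite ger0_norm ?flat_ge0//; apply: (le_trans (flat_le _ (ltW h0))).
    by rewrite mulrC -ler_pdivlMr// (le_trans _ hle)// ler_norm.
  apply: DeriveDef; first by apply: cvgP H.
  exact: cvg_lim H.
Unshelve. all: by end_near. Qed.

Lemma smooth_flat j U : smooth U (flat j).
Proof.
move=> m; elim: m j => // m IH j.
exists (fun x => - j%:R * flat j.+1 x + flat j.+2 x).
  by move=> x _; exact: is_derive_flat.
by apply: diffnD => //; apply: diffnM => //; exact: diffn_cst.
Qed.

Lemma flat0_le1 x : flat 0 x <= 1.
Proof.
rewrite /flat expr0 mul1r; case: ifP => // x0.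
by rewrite -expR0 ler_expR oppr_le0 invr_ge0 ltW.
Qed.

Lemma flat0_ge x : 1 <= x -> expR (-1) <= flat 0 x.
Proof.
move=> x1; have x0 := lt_le_trans ltr01 x1.
by rewrite /flat expr0 mul1r x0 ler_expR lerN2 invf_le1.
Qed.

End FlatFunction.

(** * A slow transition from slope delta to slope 1 *)

Section Profile.
Variable R : realType.
Implicit Types (f g F : R -> R) (a b x y t : R).

Lemma mean_value F f x y : x <= y ->
  (forall t, x <= t <= y -> is_derive t 1 F (f t)) ->
  exists2 c, x <= c <= y & F y - F x = f c * (y - x).
Proof.
move=> xy dF.
have [||c] := @MVT_segment R F f x y xy.
- by move=> t; rewrite in_itv /= => /andP[xt ty]; apply: dF; rewrite !ltW.
- apply: continuous_in_subspaceT => t.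
  rewrite inE /= in_itv /= => txy.
  exact: is_derive_continuous (dF t txy).
- by rewrite in_itv /= => cxy e; exists c.
Qed.

Lemma derive_constant F f x y : x <= y ->
  (forall t, x <= t <= y -> is_derive t 1 F (f t)) ->
  (forall t, x <= t <= y -> f t = 0) -> F x = F y.
Proof.
move=> xy dF f0; have [c cxy] := mean_value xy dF.
by rewrite f0// mul0r => /eqP; rewrite subr_eq0 => /eqP.
Qed.

Lemma derive_le F f x y : x <= y ->
  (forall t, x <= t <= y -> is_derive t 1 F (f t)) ->
  (forall t, x <= t <= y -> 0 <= f t) -> F x <= F y.
Proof.
move=> xy dF f0; have [c cxy e] := mean_value xy dF.
by rewrite -subr_ge0 e mulr_ge0 ?f0 ?subr_ge0.
Qed.

(** The base point of the integral is a; the margin between b and a makes f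
    continuous on the closed intervals [a, x + 1]. *)
Lemma primitive f b a : b < a -> (forall x, b < x -> {for x, continuous f}) ->
  exists F, forall x, a < x -> is_derive x 1 F (f x).
Proof.
move=> ba cf.
exists (fun x => (\int[@lebesgue_measure R]_(t in [set` `[a, x]]) f t)%R) => x ax.
have xx1 : x < x + 1 by rewrite ltrDl.
have If : (@lebesgue_measure R).-integrable `[a, (x + 1)] (EFin \o f).
  apply: continuous_compact_integrable; first exact: segment_compact.
  apply: continuous_in_subspaceT => t; rewrite inE /= in_itv /= => /andP[at_ _].
  exact/cf/(lt_le_trans ba).
have [d e] := continuous_FTC1_closed xx1 If ax (cf x (lt_trans ba ax)).
by apply: DeriveDef => //; rewrite -derive1E.
Qed.

(** The weight 1/t is what keeps t f(t) bounded independently of b, while the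
    integral of f over [a + 1, b - 1] grows like ln b. *)
Lemma bump a b : 0 < a -> a < b -> exists f,
  [/\ forall t, t < a \/ 0 < t -> {for t, continuous f},
      smooth [set t | 0 < t] f,
      forall t, t <= a \/ b <= t -> f t = 0,
      forall t, 0 <= f t /\ t * f t <= 1 &
      forall t, a + 1 <= t <= b - 1 -> expR (-1) <= t * f t].
Proof.
move=> a0 ab; pose f t := flat 0 ((t - a) * (b - t)) * t^-1.
have f0 t : t <= a \/ b <= t -> f t = 0.
  by move=> tab; rewrite /f flat_npos ?mul0r//; nra.
have sf : smooth [set t | 0 < t] f.
  move=> m; apply: diffnM.
    apply: (@diffn_comp _ _ _ setT (flat 0) (fun t => (t - a) * (b - t))) => //.
      exact: smooth_flat.
    have sub c : diffn m [set t : R | 0 < t] (fun t => t - c).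
      by apply: diffnD; [exact: diffn_id|exact: diffn_cst].
    apply: diffnM => //; apply: diffnD; first exact: diffn_cst.
    have := diffnM (@diffn_cst _ m [set t : R | 0 < t] (-1)) (@diffn_id _ m _).
    by congr diffn; apply/funext => t; rewrite mulN1r.
  by apply: diffn_inv => t /= t0; rewrite gt_eqF.
exists f; split => //.
- move=> t [ta|t0]; last first.
    by have [f' df _] := sf 1%N; exact: is_derive_continuous (df t t0).
  have d : is_derive t 1 f 0.
    apply: (@is_derive_open _ [set t | t < a] (fun=> 0)) => //.
    by move=> y /= ya; rewrite f0//; left; exact: ltW.
  exact: is_derive_continuous d.
- move=> t; have [ta|ta] := leP t a; first by rewrite f0; [rewrite mulr0|left].
  have t0 : 0 < t by exact: lt_trans ta.
  split; first by rewrite mulr_ge0 ?flat_ge0// invr_ge0 ltW.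
  by rewrite mulrC divfK ?gt_eqF//; exact: flat0_le1.
- move=> t tab; have t0 : 0 < t by lra.
  by rewrite mulrC divfK ?gt_eqF//; apply: flat0_ge; nra.
Qed.

(** The bump of [a, b] has an integral M at least
    e^-1 (ln (b - 1) - ln (a + 1)).  For b large this exceeds 1 / kappa, and
    dg is the bump divided by M. *)
Lemma slow_step a kappa : 0 < a -> 0 < kappa -> exists b g dg,
  [/\ a < b,
      forall t, -2 < t -> is_derive t 1 g (dg t),
      continuous dg /\ smooth [set t | 0 < t] dg,
      forall t, t <= a \/ b <= t -> dg t = 0 &
      [/\ forall t, 0 <= dg t /\ t * dg t <= kappa,
          forall t, -2 < t <= a -> g t = 0 &
          forall t, b <= t -> g t = 1]].
Proof.
move=> a0 k0; pose K : R := expR (-1); have K0 : 0 < K by exact: expR_gt0.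
pose L := (K * kappa)^-1; have L0 : 0 < L by rewrite invr_gt0 mulr_gt0.
(* Chosen so that K (ln (b - 1) - ln (a + 1)) = K L = 1 / kappa. *)
pose b := (a + 1) * expR L + 1.
have a1b1 : a + 1 <= b - 1.
  by rewrite /b addrK ler_peMr; [|lra|rewrite -expR0 ler_expR ltW].
have ab : a < b by lra.
have [f [cf' sf f0 f1 fK]] := bump a0 ab.
have cf : continuous f.
  by move=> t; apply: cf'; have [|] := ltP t a; [left|right; lra].
have m32 : - 3 < - 2 :> R by lra.
have [F dF] := primitive m32 (fun x _ => cf x).
pose M := F b - F a.
have MK : kappa^-1 <= M.
  (* Nondecreasing where t f(t) >= K. *)
  pose H t := F t - K * ln t.
  have dH t : a <= t <= b -> is_derive t 1 H (f t - K * t^-1).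
    move=> tab; have dln : is_derive t 1 (@ln R) t^-1 by apply: is_derive1_ln; lra.
    have dFt : is_derive t 1 F (f t) by apply: dF; lra.
    exact: is_deriveB dFt (is_deriveZ K dln).
  have : H (a + 1) <= H (b - 1).
    apply: derive_le a1b1 _ _ => [t tab|t tab]; first by apply: dH; lra.
    rewrite subr_ge0 ler_pdivrMr; last by lra.
    by rewrite mulrC; exact: fK.
  have dle x y : a <= x -> x <= y -> y <= b -> F x <= F y.
    move=> ax xy yb; apply: derive_le xy _ _ => t txy; first by apply: dF; lra.
    exact: (f1 t).1.
  have h1 : F a <= F (a + 1) by apply: dle; lra.
  have h2 : F (b - 1) <= F b by apply: dle; lra.
  rewrite /H /M => h3.
  have lnb : K * ln (b - 1) - K * ln (a + 1) = kappa^-1.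
    rewrite -mulrBr -ln_div ?posrE; [|rewrite /b addrK mulr_gt0 ?expR_gt0//; lra|lra].
    rewrite /b addrK [(a + 1) * _]mulrC mulfK; last by rewrite gt_eqF//; lra.
    by rewrite expRK /L invfM mulrA divff ?mul1r// gt_eqF.
  rewrite -lnb; lra.
have M0 : 0 < M by apply: lt_le_trans MK; rewrite invr_gt0.
exists b, (fun t => M^-1 * (F t - F a)), (fun t => M^-1 * f t); split => //.
- move=> t t1; have := is_deriveZ M^-1 (is_deriveB (dF t t1) (is_derive_cst (F a) t 1)).
  by rewrite subr0.
- split; last by move=> m; apply: diffnM => //; exact: diffn_cst.
  by move=> t; apply: cvgM; [exact: cvg_cst|exact: cf].
- by move=> t /f0 ->; rewrite mulr0.
split=> t.
- split; first by apply: mulr_ge0 (f1 t).1; rewrite invr_ge0 ltW.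
  rewrite mulrCA ler_pdivrMl//; apply: le_trans (f1 t).2 _.
  by rewrite -ler_pdivrMr// mul1r.
- move=> /andP[t1 ta]; suff -> : F t = F a by rewrite subrr mulr0.
  apply: (derive_constant ta (f := f)) => y ya; first by apply: dF; lra.
  by apply: f0; left; lra.
- move=> bt; suff <- : F b = F t by rewrite mulVf// gt_eqF.
  apply: (derive_constant bt (f := f)) => y ya; first by apply: dF; lra.
  by apply: f0; right; lra.
Qed.

End Profile.

Section ConvexFunctions.
Variable R : realType.
Implicit Types (h dh ddh : R -> R) (s t : R).

Lemma derive_increasing h dh : (forall t, 0 <= t -> is_derive t 1 h (dh t)) ->
  (forall t, 0 <= t -> 0 < dh t) -> forall s t, 0 <= s -> s < t -> h s < h t.
Proof.
move=> Dh dh0 s t s0 st.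
have [|c cst e] := mean_value (ltW st) (F := h) (f := dh).
  by move=> u ust; apply: Dh; lra.
by rewrite -subr_gt0 e mulr_gt0 ?subr_gt0// dh0//; lra.
Qed.

(** The graph lies above its tangents; the tangent at the barycentre is compared
    with both end points. *)
Lemma derive_convex h dh ddh : (forall t, 0 <= t -> is_derive t 1 h (dh t)) ->
  (forall t, 0 <= t -> is_derive t 1 dh (ddh t)) ->
  (forall t, 0 <= ddh t) -> @convex_function R R^o [set t : R | 0 <= t] h.
Proof.
move=> Dh Ddh ddh0.
have mono s t : 0 <= s -> s <= t -> dh s <= dh t.
  move=> s0 st; apply: (derive_le st (f := ddh)) => // u ust.
  by apply: Ddh; lra.
have tangent s t : 0 <= s -> 0 <= t -> h s + dh s * (t - s) <= h t.
  move=> s0 t0; have [st|/ltW ts] := leP s t.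
    have [|c cst e] := mean_value st (F := h) (f := dh).
      by move=> u ust; apply: Dh; lra.
    by have := mono s c s0; nra.
  have [|c cst e] := mean_value ts (F := h) (f := dh).
    by move=> u ust; apply: Dh; lra.
  by have c0 : 0 <= c by [lra]; have := mono c s c0; nra.
move=> w x y; rewrite !inE /= => x0 y0.
have -> : h (conv w x y) = h (w%:num * x + (1 - w%:num) * y).
  by congr h; exact: convRE.
rewrite convRE /unstable.onem.
have t0 : 0 <= w%:num by []. have t1 : w%:num <= 1 by [].
move: (w%:num) t0 t1 => t t0 t1.
pose z := t * x + (1 - t) * y.
change (h z <= t * h x + (1 - t) * h y).
have z0 : 0 <= z by rewrite /z; nra.
have tx := ler_wpM2l t0 (tangent z x z0 x0).
have t1' : 0 <= 1 - t by lra.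
have ty := ler_wpM2l t1' (tangent z y z0 y0).
have e : dh z * (t * (x - z) + (1 - t) * (y - z)) = 0 by rewrite /z; ring.
clearbody z; lra.
Qed.

End ConvexFunctions.

Section ProfileFunction.
Variable R : realType.
Implicit Types (t x y : R).

(** The function h of the construction, with its first two derivatives.  They
    exist on a neighbourhood of the half-line, because h is composed with
    |x|^2, which takes the value 0. *)
Lemma profile (r eps lam : R) : 0 < r -> 0 < eps -> 1 < lam ->
  exists (c0 R0 delta : R) (h dh ddh : R -> R),
  [/\ r < c0, c0 < R0 & 0 < delta] /\
  [/\ forall t, -1 < t -> is_derive t 1 h (dh t),
      forall t, -1 < t -> is_derive t 1 dh (ddh t),
      continuous ddh & smooth_on [set t : R | 0 <= t] h] /\
  [/\ forall t, 0 <= t -> 0 < dh t <= 1, forall t, 0 <= ddh t &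
      forall t, 0 <= t -> dh t + 2 * t * ddh t < lam] /\
  [/\ forall t, 0 <= t <= r -> [/\ h t = delta * t, dh t = delta & ddh t = 0],
      forall t, R0 <= t -> h t = t - c0,
      forall t, 0 <= t -> 0 <= h t /\ t - c0 <= h t &
      forall t, 0 <= t -> h t < t - r \/ h t < eps].
Proof.
move=> r0 eps0 lam1.
(* Small enough for h <= delta a < eps on [0, a] and a (1 - delta) > r. *)
pose delta := eps / (4 * (r + eps)).
have d0 : 0 < delta by rewrite divr_gt0// mulr_gt0//; lra.
have [d2 deps] : delta < 1 / 2 /\ delta * (2 * r) < eps.
  have de : delta * (4 * (r + eps)) = eps by rewrite divfK// gt_eqF//; lra.
  by split; nra.
pose a := 2 * r; have a0 : 0 < a by rewrite mulr_gt0.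
(* Then h' + 2 t h'' <= 1 + (lam - 1) / 2 < lam. *)
have k0 : 0 < (lam - 1) / 4 by lra.
have [b [g [dg [ab Dg [cdg sdg] dg0 [gp ga gb]]]]] := slow_step a0 k0.
pose dh t := delta + (1 - delta) * g t.
pose ddh t := (1 - delta) * dg t.
have Ddh t : -2 < t -> is_derive t 1 dh (ddh t).
  move=> t2; have := is_deriveD (is_derive_cst delta t 1)
                               (is_deriveZ (1 - delta) (Dg t t2)).
  by rewrite add0r.
have m21 : - 2 < - 1 :> R by lra.
have cdh t : -2 < t -> {for t, continuous dh}.
  by move=> t2; exact: (is_derive_continuous (Ddh t t2)).
have [F DF] := primitive m21 cdh.
pose h t := F t - F 0.
have Dh t : -1 < t -> is_derive t 1 h (dh t).
  move=> t1; have := is_deriveB (DF t t1) (is_derive_cst (F 0) t 1).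
  by rewrite subr0.
have DhZ k t : -1 < t -> is_derive t 1 (fun t => k * t - h t) (k - dh t).
  move=> t1; have := is_deriveB (is_deriveZ k (is_derive_id t (1:R))) (Dh t t1).
  by rewrite /GRing.scale /= mulr1.
have h0 : h 0 = 0 by rewrite /h subrr.
have dha t : -2 < t <= a -> dh t = delta.
  by move=> /ga; rewrite /dh => ->; rewrite mulr0 addr0.
have dhb t : b <= t -> dh t = 1.
  by move=> /gb; rewrite /dh => ->; rewrite mulr1 addrC subrK.
have ha t : 0 <= t <= a -> h t = delta * t.
  move=> /andP[t0 ta].
  have := derive_constant t0 (F := fun t => delta * t - h t)
            (f := fun t => delta - dh t).
  rewrite mulr0 h0 subr0 => H.
  suff : 0 = delta * t - h t by lra.
  apply: H; first by move=> y yt; apply: DhZ; lra.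
  by move=> y yt; rewrite dha ?subrr//; lra.
have gmono x y : 0 <= x -> x <= y -> g x <= g y.
  move=> x0 xy; apply: (derive_le xy (f := dg)) => t xt; first by apply: Dg; lra.
  exact: (gp t).1.
have g01 t : 0 <= t -> 0 <= g t <= 1.
  move=> t0; apply/andP; split.
    by rewrite -(ga 0) ?gmono//; lra.
  have [tb|bt] := leP t b; first by rewrite -(gb b)// gmono.
  by rewrite (gb t)// ltW.
have dh01 t : 0 <= t -> 0 < dh t <= 1.
  move=> /g01; rewrite /dh => /andP[? ?]; nra.
have hlt x y : 0 <= x -> x <= y -> x - h x <= y - h y.
  move=> x0 xy; suff : 1 * x - h x <= 1 * y - h y by rewrite !mul1r.
  apply: (derive_le xy (F := fun t => 1 * t - h t) (f := fun t => 1 - dh t)).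
    by move=> t xt; apply: DhZ; lra.
  move=> t xt; have t0 : 0 <= t by lra.
  by have /andP[_] := dh01 t t0; rewrite subr_ge0.
have hmono x y : 0 <= x -> x <= y -> h x <= h y.
  move=> x0 xy; apply: (derive_le xy (f := dh)) => t xt; first by apply: Dh; lra.
  have t0 : 0 <= t by lra.
  by have /andP[/ltW] := dh01 t t0.
have hbE t : b <= t -> h t = t - (b - h b).
  move=> bt; have b0 : 0 <= b by lra.
  have := derive_constant bt (F := fun t => 1 * t - h t) (f := fun t => 1 - dh t).
  rewrite !mul1r => H; suff : b - h b = t - h t by lra.
  apply: H; first by move=> y yt; apply: DhZ; lra.
  by move=> y yt; rewrite dhb ?subrr//; lra.
have aha : r < a - h a by rewrite ha /a; nra.
exists (b - h b), b, delta, h, dh, ddh; split; [split=> //|split; [split|split; split]].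
- by apply: lt_le_trans aha _; apply: hlt; lra.
- rewrite ltrBlDr ltrDl; apply: lt_le_trans (_ : 0 < h a) _.
    by rewrite ha; [exact: mulr_gt0|rewrite lexx ltW].
  by apply: hmono; lra.
- exact: Dh.
- by move=> t t1; apply: Ddh; lra.
- by move=> t; apply: cvgM; [exact: cvg_cst|exact: cdg].
- move=> x /= x0; have [xa|ax] := ltP x a.
    (* h'' is known to be smooth only for t > 0; below a, h is linear. *)
    exists [set t | -1 < t < a], h; split=> //.
    + rewrite (_ : [set t | _] = [set` `]-1, a[]); first exact: interval_open.
      by apply/seteqP; split=> t /=; rewrite in_itv.
    + by rewrite /= xa andbT; lra.
    + apply: smooth_onP.
        rewrite (_ : [set t | _] = [set` `]-1, a[]); first exact: interval_open.
        by apply/seteqP; split=> t /=; rewrite in_itv.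
      apply: (@smooth_primitive _ _ _ (fun=> delta)); last by move=> m; exact: diffn_cst.
      by move=> t /= ta; rewrite -(dha t); [apply: Dh|]; lra.
  exists [set t | 0 < t], h; split=> //=; first by lra.
  apply: smooth_onP => //.
  apply: (@smooth_primitive _ _ _ dh); first by move=> t /= t0; apply: Dh; lra.
  apply: (@smooth_primitive _ _ _ ddh); first by move=> t /= t0; apply: Ddh; lra.
  by move=> m; apply: diffnM => //; exact: diffn_cst.
- exact: dh01.
- by move=> t; apply: mulr_ge0 (gp t).1; lra.
- move=> t t0; have /andP[_ ?] := dh01 t t0; have [? ?] := gp t.
  rewrite /ddh; nra.
- move=> t tr; split; first by apply: ha; rewrite /a; lra.
    by apply: dha; rewrite /a; lra.
  by rewrite /ddh dg0 ?mulr0//; left; rewrite /a; lra.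
- exact: hbE.
- move=> t t0; split; first by rewrite -h0 hmono.
  have [tb|bt] := leP t b; first by have := hlt t b t0 tb; lra.
  by rewrite (hbE t (ltW bt)).
- move=> t t0; have [ta|ta] := leP t a.
    by right; rewrite ha ?t0//; apply: le_lt_trans deps; rewrite ler_pM2l.
  by left; have := hlt a t (ltW a0) (ltW ta); lra.
Qed.

End ProfileFunction.

(** * Real quadratic forms *)

Section QuadraticForms.
Variable R : realType.

Lemma dotpE n (u v : 'cV[R]_n) : dotp u v = (u^T *m v) 0 0.
Proof. by rewrite /dotp mxE; apply: eq_bigr => i _; rewrite mxE. Qed.

Lemma dotpC n (u v : 'cV[R]_n) : dotp u v = dotp v u.
Proof. by apply: eq_bigr => i _; rewrite mulrC. Qed.

Lemma dotpDl n (u v w : 'cV[R]_n) : dotp (u + v) w = dotp u w + dotp v w.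
Proof. by rewrite !dotpE linearD mulmxDl mxE. Qed.

Lemma dotpDr n (u v w : 'cV[R]_n) : dotp w (u + v) = dotp w u + dotp w v.
Proof. by rewrite !(dotpC w) dotpDl. Qed.

Lemma dotpZl n a (u v : 'cV[R]_n) : dotp (a *: u) v = a * dotp u v.
Proof. by rewrite !dotpE linearZ -scalemxAl mxE. Qed.

Lemma dotpZr n a (u v : 'cV[R]_n) : dotp u (a *: v) = a * dotp u v.
Proof. by rewrite dotpC dotpZl dotpC. Qed.

Lemma dotpNl n (u v : 'cV[R]_n) : dotp (- u) v = - dotp u v.
Proof. by rewrite -scaleN1r dotpZl mulN1r. Qed.

Lemma dotp0l n (v : 'cV[R]_n) : dotp 0 v = 0.
Proof. by rewrite -(scale0r 0) dotpZl mul0r. Qed.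

Lemma dotp_col_mx n1 n2 (u1 v1 : 'cV[R]_n1) (u2 v2 : 'cV[R]_n2) :
  dotp (col_mx u1 u2) (col_mx v1 v2) = dotp u1 v1 + dotp u2 v2.
Proof. by rewrite !dotpE tr_col_mx mul_row_col mxE. Qed.

Lemma dotp_adj m n (M : 'M[R]_(m, n)) u v : dotp (M *m u) v = dotp u (M^T *m v).
Proof. by rewrite !dotpE trmx_mul mulmxA. Qed.

Lemma dotp_delta n (i : 'I_n) (u : 'cV[R]_n) : dotp u (delta_mx i 0) = u i 0.
Proof.
rewrite /dotp (bigD1 i)//= big1 ?addr0 => [|j ji].
  by rewrite mxE !eqxx mulr1.
by rewrite mxE (negbTE ji) mulr0.
Qed.

Lemma dotp_rank1 n (c w : 'cV[R]_n) : dotp (c *m c^T *m w) w = dotp c w ^+ 2.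
Proof.
by rewrite -mulmxA [c^T *m w]mx11_scalar -dotpE mul_mx_scalar dotpZl.
Qed.

Lemma sqnorm_ge0 n (u : 'cV[R]_n) : 0 <= sqnorm u.
Proof. by apply: sumr_ge0 => i _; rewrite -expr2 sqr_ge0. Qed.

Lemma sqnorm_eq0 n (u : 'cV[R]_n) : (sqnorm u == 0) = (u == 0).
Proof.
apply/idP/eqP => [|->]; last by rewrite /sqnorm dotp0l.
rewrite psumr_eq0 => [|i _]; last by rewrite -expr2 sqr_ge0.
move=> /allP u0; apply/colP => i; rewrite mxE.
by have /implyP/(_ isT) := u0 i (mem_index_enum i); rewrite -expr2 sqrf_eq0 => /eqP.
Qed.

Lemma sqnorm_gt0 n (u : 'cV[R]_n) : (0 < sqnorm u) = (u != 0).
Proof. by rewrite lt_def sqnorm_ge0 andbT sqnorm_eq0. Qed.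

Lemma posdef_ge0 n (M : 'M[R]_n) u : posdef M -> 0 <= dotp (M *m u) u.
Proof.
move=> pM; have [->|/pM/ltW//] := eqVneq u 0.
by rewrite mulmx0 dotp0l.
Qed.

Lemma dotp_CauchySchwarz n (u v : 'cV[R]_n) : dotp u v ^+ 2 <= sqnorm u * sqnorm v.
Proof.
have [->|v0] := eqVneq v 0.
  by rewrite /sqnorm dotpC !dotp0l mulr0 expr0n.
have sv : 0 < sqnorm v by rewrite sqnorm_gt0.
have := sqnorm_ge0 (sqnorm v *: u - dotp u v *: v).
rewrite -scaleNr {1}/sqnorm !(dotpDl, dotpDr, dotpZl, dotpZr) (dotpC v u).
rewrite -!/(sqnorm _) => H.
suff : 0 <= sqnorm v * (sqnorm u * sqnorm v - dotp u v ^+ 2).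
  by rewrite pmulr_rge0// subr_ge0.
lra.
Qed.

Lemma dotp_mulmx_le n (N : 'M[R]_n) : exists2 C, 0 < C &
  forall u : 'cV[R]_n, dotp (N *m u) u <= C * sqnorm u.
Proof.
exists (1 + \sum_i \sum_j `|N i j|) => [|u].
  by rewrite ltr_pwDl//; do 2!apply: sumr_ge0 => ? _.
have le2 (i j : 'I_n) : `|u j 0 * u i 0| <= sqnorm u.
  have le1 (i' : 'I_n) : u i' 0 * u i' 0 <= sqnorm u.
    rewrite /sqnorm /dotp (bigD1 i')//= lerDl.
    by apply: sumr_ge0 => ? _; rewrite -expr2 sqr_ge0.
  have := le1 i; have := le1 j; rewrite ler_norml; nra.
rewrite mulrDl mul1r ler_wpDl ?sqnorm_ge0// mulr_suml.
apply: ler_sum => i _; rewrite mxE !mulr_suml; apply: ler_sum => j _.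
apply: (le_trans (ler_norm _)); rewrite -mulrA normrM.
exact: ler_wpM2l.
Qed.

Lemma posdef_unit n (M : 'M[R]_n) : posdef M -> M \in unitmx.
Proof.
move=> pM; rewrite -row_free_unit; apply: inj_row_free => w wM.
apply/eqP/contraT => w0.
have wT0 : w^T != 0 by apply: contraNneq w0 => /(congr1 trmx); rewrite trmxK trmx0 => ->.
by have := pM _ wT0; rewrite dotpC dotpE trmxK mulmxA wM mul0mx mxE ltxx.
Qed.

(** The form of M is nonnegative at C v - M^-1 v.  Expanding, with
    <v, M^-1 v> <= C |v|^2, leaves C^2 <M v, v> >= C |v|^2; so 1 / C is a lower
    bound for the spectrum, and no eigenvalue has to be produced. *)
Lemma posdef_coercive n (M : 'M[R]_n) : M^T = M -> posdef M ->
  exists2 mu, 0 < mu & forall u, mu * sqnorm u <= dotp (M *m u) u.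
Proof.
move=> sM pM; have uM := posdef_unit pM.
have [C C0 leC] := dotp_mulmx_le (invmx M).
exists C^-1 => [|v]; first by rewrite invr_gt0.
have := posdef_ge0 (C *: v - invmx M *m v) pM.
rewrite mulmxBr mulKVmx// -scalemxAr -scaleN1r -[- (_ *m _)]scaleN1r.
rewrite !(dotpDl, dotpDr, dotpZl, dotpZr).
rewrite [dotp (M *m v) (_ *m _)]dotp_adj sM mulKVmx// -/(sqnorm v).
rewrite [dotp v (_ *m _)]dotpC => H.
rewrite ler_pdivrMl//.
have := leC v; nra.
Qed.

End QuadraticForms.

(** * Real coordinates and partial derivatives on complex space *)

Section ComplexCoordinates.
Local Open Scope complex_scope.
Variables (R : realType) (n : nat).
Notation Cn := 'cV[R[i]]_n.
Implicit Types (p : Cn) (f g : Cn -> R) (a b : 'I_(n + n)).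

Lemma Re_continuous : continuous (@complex.Re R : R[i] -> R).
Proof.
move=> z; apply/(@cvgrPdist_lt _ _ _ (nbhs z)) => e e0.
have e0' : 0 < e%:C :> R[i] by rewrite ltcR.
near=> y; rewrite -ltcR.
have : `|z - y| < e%:C.
  by near: y; exact: (@cvgr_dist_lt _ _ _ (nbhs z) _ id z cvg_id _ e0').
apply: le_lt_trans.
by rewrite -raddfB; exact: normc_ge_Re.
Unshelve. all: by end_near. Qed.

Lemma normc_ge_Im (x : R[i]) : `|complex.Im x|%:C <= `|x|.
Proof.
by case: x => x y; simpc; rewrite -sqrtr_sqr ler_wsqrtr // lerDr sqr_ge0.
Qed.

Lemma Im_continuous : continuous (@complex.Im R : R[i] -> R).
Proof.
move=> z; apply/(@cvgrPdist_lt _ _ _ (nbhs z)) => e e0.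
have e0' : 0 < e%:C :> R[i] by rewrite ltcR.
near=> y; rewrite -ltcR.
have : `|z - y| < e%:C.
  by near: y; exact: (@cvgr_dist_lt _ _ _ (nbhs z) _ id z cvg_id _ e0').
apply: le_lt_trans.
by rewrite -raddfB; exact: normc_ge_Im.
Unshelve. all: by end_near. Qed.

Definition rcoord p : 'cV[R]_(n + n) :=
  col_mx (map_mx (@complex.Re R) p) (map_mx (@complex.Im R) p).

Lemma rcoord_continuous a : continuous (fun p => rcoord p a 0).
Proof.
rewrite -(splitK a); case: (fintype.split a) => j p /=.
  rewrite (_ : (fun _ => _) = @complex.Re R \o (fun p : Cn => p j 0)).
    by apply: continuous_comp; [exact: coord_continuous|exact: Re_continuous].
  by apply/funext => q; rewrite /rcoord /unsplit col_mxEu mxE.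
rewrite (_ : (fun _ => _) = @complex.Im R \o (fun p : Cn => p j 0)).
  by apply: continuous_comp; [exact: coord_continuous|exact: Im_continuous].
by apply/funext => q; rewrite /rcoord /unsplit col_mxEd mxE.
Qed.

Lemma rcoord_line p a (t : R) :
  rcoord (p + t%:C *: real_dir R a) = rcoord p + t *: delta_mx a 0.
Proof.
apply/colP => b; transitivity (rcoord p b 0 + t * (b == a)%:R); last first.
  by move: (rcoord p) => u; rewrite !mxE eqxx andbT.
rewrite /real_dir /rcoord -[in RHS](splitK a) -(splitK b).
case: (fintype.split a) => i; case: (fintype.split b) => j;
  rewrite /unsplit ?col_mxEu ?col_mxEd !mxE
    ?eq_lshift ?eq_rshift ?eq_lrshift ?eq_rlshift.
all: by case: (p j 0) => u v; case: (j == i) => /=; simpc; rewrite /=; ring.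
Qed.

Lemma rcoord0 : rcoord 0 = 0.
Proof. by rewrite /rcoord !map_mx0 // col_mx0. Qed.

End ComplexCoordinates.

Section PartialDerivatives.
Local Open Scope complex_scope.
Variables (R : realType) (n : nat).
Notation Cn := 'cV[R[i]]_n.
Implicit Types (p : Cn) (f g : Cn -> R) (a b : 'I_(n + n)).

Definition has_pderiv a f f' :=
  forall p, is_derive (0 : R) (1 : R) (line f p a) (f' p).

Lemma has_pderiv_partial a f f' : has_pderiv a f f' -> partial a f = f'.
Proof.
by move=> df; apply/funext => p; rewrite /partial derive1E; have [_ ->] := df p.
Qed.

Lemma has_pderivP a f f' p : has_pderiv a f f' -> has_partial f a p.
Proof. by move=> df; apply: ex_derive; exact: df. Qed.

Lemma has_pderivB a f g f' g' : has_pderiv a f f' -> has_pderiv a g g' ->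
  has_pderiv a (fun p => f p - g p) (fun p => f' p - g' p).
Proof. by move=> df dg p; have := is_deriveB (df p) (dg p). Qed.

Lemma has_pderivZ a f f' k : has_pderiv a f f' ->
  has_pderiv a (fun p => k * f p) (fun p => k * f' p).
Proof. by move=> df p; have := is_deriveZ k (df p). Qed.

Lemma line0 f p a : line f p a 0 = f p.
Proof. by rewrite /line scale0r addr0. Qed.

Lemma has_pderivM a f g f' g' : has_pderiv a f f' -> has_pderiv a g g' ->
  has_pderiv a (fun p => f p * g p) (fun p => f p * g' p + g p * f' p).
Proof.
by move=> df dg p; have := is_deriveM (df p) (dg p); rewrite !line0.
Qed.

Lemma has_pderiv_comp a f f' (h dh : R -> R) :
  (forall p, is_derive (f p) 1 h (dh (f p))) -> has_pderiv a f f' ->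
  has_pderiv a (fun p => h (f p)) (fun p => dh (f p) * f' p).
Proof.
move=> Dh df p; have hp := Dh p; rewrite -(line0 f p a) in hp.
by have := is_derive1_comp hp (df p); rewrite !line0.
Qed.

Lemma is_derive_quadratic (q l m : R) :
  is_derive (0 : R) (1 : R) (fun t => q + t * l + t * t * m) l.
Proof.
have di := is_derive_id (0 : R) (1 : R).
have cst (k : R) := is_derive_cst k (0 : R) (1 : R).
have := is_deriveD (is_deriveD (cst q) (is_deriveM di (cst l)))
                   (is_deriveM (is_deriveM di di) (cst m)).
by rewrite /GRing.scale /= !(mulr0, mul0r, mulr1, add0r, addr0).
Qed.

Lemma has_pderiv_linear (M : 'M[R]_(n + n)) a b :
  has_pderiv b (fun p => (M *m rcoord p) a 0) (fun=> M a b).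
Proof.
move=> p.
rewrite (_ : line _ _ _ = fun t => (M *m rcoord p) a 0 + t * M a b + t * t * 0).
  exact: is_derive_quadratic.
apply/funext => t; rewrite /line rcoord_line mulmxDr -scalemxAr.
rewrite mulr0 addr0 [LHS]mxE; congr (_ + _).
by rewrite mxE -colE mxE.
Qed.

Lemma has_pderiv_quadratic (M : 'M[R]_(n + n)) b : M^T = M ->
  has_pderiv b (fun p => dotp (M *m rcoord p) (rcoord p))
    (fun p => 2 * (M *m rcoord p) b 0).
Proof.
move=> sM p.
rewrite (_ : line _ _ _ = fun t => dotp (M *m rcoord p) (rcoord p) +
  t * (2 * (M *m rcoord p) b 0) + t * t * dotp (M *m delta_mx b 0) (delta_mx b 0)).
  exact: is_derive_quadratic.
apply/funext => t; rewrite /line rcoord_line mulmxDr -scalemxAr.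
rewrite !(dotpDl, dotpDr, dotpZl, dotpZr).
rewrite [dotp (M *m delta_mx _ _) (rcoord p)]dotp_adj sM.
rewrite [dotp (delta_mx _ _) _]dotpC !dotp_delta; ring.
Qed.

Lemma mulmx_rcoord_continuous (M : 'M[R]_(n + n)) a :
  continuous (fun p => (M *m rcoord p) a 0).
Proof.
rewrite (_ : (fun p => _) = fun p => \sum_j M a j * rcoord p j 0); last first.
  by apply/funext => p; rewrite mxE.
apply: continuous_big => [|j _ p]; first exact: add_continuous.
by apply: continuousM; [exact: cst_continuous|exact: rcoord_continuous].
Qed.

Lemma quadratic_rcoord_continuous (M : 'M[R]_(n + n)) :
  continuous (fun p => dotp (M *m rcoord p) (rcoord p)).
Proof.
apply: continuous_big => [|j _ p]; first exact: add_continuous.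
by apply: continuousM; [exact: mulmx_rcoord_continuous|exact: rcoord_continuous].
Qed.

Lemma has_pderiv_C2_on V f (f1 : 'I_(n + n) -> Cn -> R)
    (f2 : 'I_(n + n) -> 'I_(n + n) -> Cn -> R) : continuous f ->
  (forall a, has_pderiv a f (f1 a) /\ continuous (f1 a)) ->
  (forall a b, has_pderiv b (f1 a) (f2 a b) /\ continuous (f2 a b)) ->
  C2_on V f.
Proof.
move=> cf df ddf p _; split; first exact: cf.
move=> a; have [dfa cfa] := df a; rewrite (has_pderiv_partial dfa).
split; [exact: has_pderivP dfa|exact: cfa|move=> b].
have [dfab cfab] := ddf a b; rewrite (has_pderiv_partial dfab).
by split; [exact: has_pderivP dfab|exact: cfab].
Qed.

Section Levi.
Variables (f : Cn -> R) (f1 : 'I_(n + n) -> Cn -> R).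
Variables (f2 : 'I_(n + n) -> 'I_(n + n) -> Cn -> R).
Hypothesis df : forall a, has_pderiv a f (f1 a).
Hypothesis ddf : forall a b, has_pderiv b (f1 a) (f2 a b).

Lemma hessianE p : hessian f p = \matrix_(a, b) f2 b a p.
Proof.
apply/matrixP => a b; rewrite !mxE (has_pderiv_partial (df b)).
by rewrite (has_pderiv_partial (ddf b a)).
Qed.

Let half_pderiv a b : partial a (fun q => 2^-1 * f1 b q) = fun q => 2^-1 * f2 b a q.
Proof. exact/has_pderiv_partial/has_pderivZ/ddf. Qed.

Lemma dzbar_real k p :
  dzbar k (fun q => (f q)%:C) p =
  (2^-1 * f1 (lshift n k) p) +i* (2^-1 * f1 (rshift n k) p).
Proof.
have p0 a : partial a (fun=> 0 : R) p = 0.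
  have d0 : has_pderiv a (fun=> 0) (fun=> 0) by move=> q; exact: is_derive_cst.
  by rewrite (has_pderiv_partial d0).
rewrite /dzbar /cpartial /= !p0 !(has_pderiv_partial (df _)).
by apply/eqP; rewrite eq_complex; simpc; apply/andP; split; apply/eqP => /=; field.
Qed.

Lemma dz_dzbar_real j k p :
  dz j (dzbar k (fun q => (f q)%:C)) p =
  (4^-1 * (f2 (lshift n k) (lshift n j) p + f2 (rshift n k) (rshift n j) p))
  +i* (4^-1 * (f2 (rshift n k) (lshift n j) p - f2 (lshift n k) (rshift n j) p)).
Proof.
rewrite (_ : dzbar _ _ = fun q =>
  (2^-1 * f1 (lshift n k) q) +i* (2^-1 * f1 (rshift n k) q)); last first.
  by apply/funext => q; exact: dzbar_real.
rewrite /dz /cpartial /= !half_pderiv.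
by apply/eqP; rewrite eq_complex; simpc; apply/andP; split; apply/eqP => /=; field.
Qed.

Hypothesis f2C : forall a b p, f2 a b p = f2 b a p.

(** The Levi form averages the real Hessian over v and iv.  Termwise, the pure
    second derivatives add up and the mixed ones combine by symmetry, while the
    imaginary part is a sum over (j, k) of a skew-symmetric expression. *)
Lemma leviE p v :
  levi f p v = (4^-1 * (dotp (hessian f p *m rcoord v) (rcoord v) +
    dotp (hessian f p *m rcoord ('i *: v)) (rcoord ('i *: v))))%:C.
Proof.
pose x j := complex.Re (v j 0); pose y j := complex.Im (v j 0).
pose T a b := f2 b a p.
pose l := @lshift n n; pose r := @rshift n n.
have form (w : 'cV[R]_(n + n)) : dotp (hessian f p *m w) w =
    \sum_j \sum_k (T (l j) (l k) * w (l k) 0 * w (l j) 0 +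
      T (l j) (r k) * w (r k) 0 * w (l j) 0 +
      T (r j) (l k) * w (l k) 0 * w (r j) 0 +
      T (r j) (r k) * w (r k) 0 * w (r j) 0).
  rewrite hessianE /dotp big_split_ord /= -big_split; apply: eq_bigr => j _ /=.
  rewrite !mxE !big_split_ord /= !mulrDl !mulr_suml -!big_split /=.
  by apply: eq_bigr => i _; rewrite !mxE /T !addrA.
have rl w j : rcoord w (l j) 0 = complex.Re (w j 0) :> R.
  by rewrite /rcoord col_mxEu mxE.
have rr w j : rcoord w (r j) 0 = complex.Im (w j 0) :> R.
  by rewrite /rcoord col_mxEd mxE.
have il j : rcoord ('i *: v) (l j) 0 = - y j.
  by rewrite rl mxE /y; case: (v j 0) => a b; simpc.
have ir j : rcoord ('i *: v) (r j) 0 = x j.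
  by rewrite rr mxE /x; case: (v j 0) => a b; simpc.
(* Real and imaginary parts of the complex Hessian. *)
pose P j k := 4^-1 * (T (l j) (l k) + T (r j) (r k)).
pose S j k := 4^-1 * (T (l j) (r k) - T (r j) (l k)).
have TC a b : T a b = T b a by exact: f2C.
have -> : levi f p v =
    (\sum_j \sum_k (P j k * (x j * x k + y j * y k)
                     - S j k * (y j * x k - x j * y k)))
    +i* (\sum_j \sum_k (P j k * (y j * x k - x j * y k)
                         + S j k * (x j * x k + y j * y k))).
  rewrite /levi; apply/eqP; rewrite eq_complex; apply/andP; split; apply/eqP.
    rewrite raddf_sum; apply: eq_bigr => j _.
    rewrite raddf_sum; apply: eq_bigr => i _.
    rewrite dz_dzbar_real /P /S /T /l /r /x /y.
    by case: (v j 0) => a b; case: (v i 0) => c d /=; ring.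
  rewrite raddf_sum; apply: eq_bigr => j _.
  rewrite raddf_sum; apply: eq_bigr => i _.
  rewrite dz_dzbar_real /P /S /T /l /r /x /y.
  by case: (v j 0) => a b; case: (v i 0) => c d /=; ring.
apply/eqP; rewrite eq_complex /=; apply/andP; split; apply/eqP.
  rewrite !form -big_split mulr_sumr; apply: eq_bigr => j _.
  rewrite -big_split mulr_sumr; apply: eq_bigr => i _ /=.
  by rewrite !il !ir !rl !rr -/(x j) -/(x i) -/(y j) -/(y i) /P /S; field.
set s := LHS; suff : s = - s by move=> e; lra.
rewrite {1}/s exchange_big /= /s -sumrN; apply: eq_bigr => j _.
rewrite -sumrN; apply: eq_bigr => i _.
rewrite /P /S (TC (l i)) (TC (r i) (r j)) (TC (l i)) (TC (r i)); ring.
Qed.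

End Levi.
End PartialDerivatives.

(** * The function Q - h(|x|^2) *)

Section Model.
Variables (R : realType) (k m : nat) (A : 'M[R]_k) (B : 'M[R]_m).
Hypotheses (symA : A^T = A) (symB : B^T = B).
Notation n := (k + m)%N.
Notation Cn := 'cV[R[i]]_n.
Local Open Scope complex_scope.

Definition Qmx : 'M[R]_(n + n) :=
  block_mx (block_mx 0 0 0 1%:M) 0 0 (block_mx A 0 0 B).

Definition Xmx : 'M[R]_(n + n) := block_mx (block_mx 1%:M 0 0 0) 0 0 0.

Lemma rcoordE (p : Cn) :
  rcoord p = col_mx (col_mx (xpart p) (upart p)) (col_mx (ypart p) (vpart p)).
Proof. by rewrite /rcoord -{1 2}[p]vsubmxK !map_col_mx. Qed.

Lemma mul_Qmx (x y : 'cV[R]_k) (u v : 'cV[R]_m) :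
  Qmx *m col_mx (col_mx x u) (col_mx y v)
    = col_mx (col_mx 0 u) (col_mx (A *m y) (B *m v)).
Proof.
by rewrite !mul_block_col !mul0mx !(add0r, addr0) mul1mx.
Qed.

Lemma mul_Xmx (x y : 'cV[R]_k) (u v : 'cV[R]_m) :
  Xmx *m col_mx (col_mx x u) (col_mx y v) = col_mx (col_mx x 0) 0.
Proof.
by rewrite !mul_block_col !mul0mx !(add0r, addr0) mul1mx.
Qed.

Lemma trmx_Qmx : Qmx^T = Qmx.
Proof. by rewrite !tr_block_mx !trmx0 trmx1 symA symB. Qed.

Lemma trmx_Xmx : Xmx^T = Xmx.
Proof. by rewrite !tr_block_mx !trmx0 trmx1. Qed.

Lemma mul_Xmx_idem : Xmx *m Xmx = Xmx.
Proof.
by rewrite !mulmx_block !(mul0mx, mulmx0, mul1mx, addr0, add0r).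
Qed.

Lemma Qform (x y : 'cV[R]_k) (u v : 'cV[R]_m) :
  dotp (Qmx *m col_mx (col_mx x u) (col_mx y v)) (col_mx (col_mx x u) (col_mx y v))
   = dotp (A *m y) y + dotp (B *m v) v + sqnorm u.
Proof. by rewrite mul_Qmx !dotp_col_mx dotp0l -/(sqnorm u); ring. Qed.

Lemma Xform (x y : 'cV[R]_k) (u v : 'cV[R]_m) :
  dotp (Xmx *m col_mx (col_mx x u) (col_mx y v)) (col_mx (col_mx x u) (col_mx y v))
   = sqnorm x.
Proof. by rewrite mul_Xmx !dotp_col_mx !dotp0l !addr0. Qed.

Lemma Qfun_rcoord (p : Cn) : Qfun A B p = dotp (Qmx *m rcoord p) (rcoord p).
Proof. by rewrite rcoordE Qform. Qed.

Lemma sqnorm_xpart_rcoord (p : Cn) :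
  sqnorm (xpart p) = dotp (Xmx *m rcoord p) (rcoord p).
Proof. by rewrite rcoordE Xform. Qed.

Lemma tau_rcoord h : tau A B h = fun p =>
  dotp (Qmx *m rcoord p) (rcoord p) - h (dotp (Xmx *m rcoord p) (rcoord p)).
Proof. by apply/funext => p; rewrite /tau Qfun_rcoord sqnorm_xpart_rcoord. Qed.

Variables (h dh ddh : R -> R).
Hypothesis Dh : forall t : R, 0 <= t -> is_derive t 1 h (dh t).
Hypothesis Ddh : forall t : R, 0 <= t -> is_derive t 1 dh (ddh t).
Hypothesis cddh : continuous ddh.

Let X2 (p : Cn) := dotp (Xmx *m rcoord p) (rcoord p).

Let X2_ge0 p : 0 <= X2 p.
Proof. by rewrite /X2 -sqnorm_xpart_rcoord sqnorm_ge0. Qed.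

Definition tau1 (a : 'I_(n + n)) (p : Cn) : R :=
  2 * (Qmx *m rcoord p) a 0 - dh (X2 p) * (2 * (Xmx *m rcoord p) a 0).

Definition tau2 (a b : 'I_(n + n)) (p : Cn) : R :=
  2 * Qmx a b - (dh (X2 p) * (2 * Xmx a b) +
    2 * (Xmx *m rcoord p) a 0 * (ddh (X2 p) * (2 * (Xmx *m rcoord p) b 0))).

Lemma has_pderiv_tau a : has_pderiv a (tau A B h) (tau1 a).
Proof.
rewrite tau_rcoord; apply: has_pderivB; first exact: has_pderiv_quadratic trmx_Qmx.
apply: (has_pderiv_comp (f := X2)); first by move=> p; exact: Dh.
exact: has_pderiv_quadratic trmx_Xmx.
Qed.

Lemma has_pderiv_tau1 a b : has_pderiv b (tau1 a) (tau2 a b).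
Proof.
apply: has_pderivB; first by apply: has_pderivZ; exact: has_pderiv_linear.
apply: has_pderivM; last by apply: has_pderivZ; exact: has_pderiv_linear.
apply: (has_pderiv_comp (f := X2)); first by move=> p; exact: Ddh.
exact: has_pderiv_quadratic trmx_Xmx.
Qed.

Lemma C2_on_tau V : C2_on V (tau A B h).
Proof.
have cX : continuous X2 by exact: quadratic_rcoord_continuous.
have ch (g : R -> R) : (forall t, 0 <= t -> {for t, continuous g}) ->
    continuous (fun p : Cn => g (X2 p)).
  by move=> cg p; apply: (continuous_comp (cX p)); exact: cg.
have cdh : continuous (fun p : Cn => dh (X2 p)).
  by apply: ch => t t0; exact: is_derive_continuous (Ddh t0).
have cB (f g : Cn -> R) : continuous f -> continuous g ->
    continuous (fun p => f p - g p).
  by move=> cf cg p; apply: continuousB; [exact: cf|exact: cg].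
have cM (f g : Cn -> R) : continuous f -> continuous g ->
    continuous (fun p => f p * g p).
  by move=> cf cg p; apply: continuousM; [exact: cf|exact: cg].
have cD (f g : Cn -> R) : continuous f -> continuous g ->
    continuous (fun p => f p + g p).
  by move=> cf cg p; apply: continuousD; [exact: cf|exact: cg].
have cl (M : 'M[R]_(n + n)) a : continuous (fun p : Cn => 2 * (M *m rcoord p) a 0).
  apply: (cM (fun=> 2)); last exact: mulmx_rcoord_continuous.
  by move=> p; exact: cst_continuous.
apply: (has_pderiv_C2_on (f1 := tau1) (f2 := tau2)) => [|a|a b].
- rewrite tau_rcoord; apply: cB; first exact: quadratic_rcoord_continuous.
  by apply: ch => t t0; exact: is_derive_continuous (Dh t0).
- split; first exact: has_pderiv_tau.
  by apply: cB; [exact: cl|apply: cM; [exact: cdh|exact: cl]].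
- split; first exact: has_pderiv_tau1.
  apply: cB; first by move=> p; exact: cst_continuous.
  apply: cD; first by apply: cM; [exact: cdh|move=> p; exact: cst_continuous].
  apply: (cM _ _); first exact: cl.
  by apply: cM; [apply: ch => t _; exact: cddh|exact: cl].
Qed.

Lemma tau2C a b p : tau2 a b p = tau2 b a p.
Proof.
rewrite /tau2 -{1}trmx_Qmx -{1}trmx_Xmx [X in 2 * X - _]mxE.
by rewrite [X in _ * (2 * X) + _]mxE; ring.
Qed.

(** The last term is the rank-one contribution of h'' to the Hessian of
    h(|x|^2). *)
Lemma hessian_tau_form p x y u v (w := col_mx (col_mx x u) (col_mx y v)) :
  dotp (hessian (tau A B h) p *m w) w =
    2 * (dotp (A *m y) y + dotp (B *m v) v + sqnorm u)
    - 2 * dh (X2 p) * sqnorm x - 4 * ddh (X2 p) * dotp (xpart p) x ^+ 2.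
Proof.
pose c := Xmx *m rcoord p.
have -> : hessian (tau A B h) p =
    2 *: Qmx + (- (2 * dh (X2 p))) *: Xmx + (- (4 * ddh (X2 p))) *: (c *m c^T).
  apply/matrixP => a b; rewrite (hessianE has_pderiv_tau has_pderiv_tau1) mxE.
  rewrite tau2C /tau2 -/c; move: Qmx Xmx c => Q X {}c.
  by rewrite !mxE (bigD1 0)//= big1 ?addr0 ?mxE => [|i]; [ring|rewrite ord1].
have ccw : dotp (c *m c^T *m w) w = dotp (xpart p) x ^+ 2.
  rewrite dotp_rank1; congr (_ ^+ 2); rewrite /c rcoordE mul_Xmx !dotp_col_mx !dotp0l.
  by rewrite !addr0.
rewrite !mulmxDl -!scalemxAl !(dotpDl, dotpZl) ccw Qform Xform; ring.
Qed.

(** Only the x-directions contribute negative terms, at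
    most (h' + 2 |x|^2 h'') times |z|^2 up to a common factor, by the
    Cauchy-Schwarz inequality, where z is the first component of v; they are
    absorbed by A. *)
Lemma levi_tau_gt0 lam p v :
  (forall y, lam * sqnorm y <= dotp (A *m y) y) -> posdef B ->
  0 <= ddh (X2 p) -> dh (X2 p) + 2 * X2 p * ddh (X2 p) < lam ->
  v != 0 -> 0 < levi (tau A B h) p v.
Proof.
move=> lamA pB ddh0 lt_lam v0.
rewrite (leviE has_pderiv_tau has_pderiv_tau1 tau2C) ltcR.
rewrite !rcoordE !hessian_tau_form.
set x := xpart p; set s := xpart v; set y := ypart v; set u := upart v; set w := vpart v.
have -> : xpart ('i *: v) = - y.
  by apply/colP => j; rewrite !mxE; case: (v _ _) => a b /=; simpc.
have -> : ypart ('i *: v) = s.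
  by apply/colP => j; rewrite !mxE; case: (v _ _) => a b /=; simpc.
have -> : upart ('i *: v) = - w.
  by apply/colP => j; rewrite !mxE; case: (v _ _) => a b /=; simpc.
have -> : vpart ('i *: v) = u.
  by apply/colP => j; rewrite !mxE; case: (v _ _) => a b /=; simpc.
have sqN d (z : 'cV[R]_d) : sqnorm (- z) = sqnorm z.
  by rewrite /sqnorm dotpNl dotpC dotpNl opprK.
rewrite !sqN (dotpC x (- y)) dotpNl (dotpC y x) sqrrN.
have nz : 0 < sqnorm s + sqnorm y + (sqnorm u + sqnorm w).
  rewrite lt_def !addr_ge0 ?sqnorm_ge0// andbT; apply: contraNneq v0.
  move=> /eqP; rewrite !paddr_eq0 ?addr_ge0 ?sqnorm_ge0// !sqnorm_eq0.
  move=> /andP[/andP[/eqP s0 /eqP y0] /andP[/eqP u0 /eqP w0]].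
  apply/eqP; rewrite -[v]vsubmxK.
  apply/colP => j; rewrite -(splitK j); case: (fintype.split j) => i /=.
    have /colP/(_ i) := s0; have /colP/(_ i) := y0; rewrite col_mxEu !mxE.
    by case: (v _ _) => a b /= -> ->.
  have /colP/(_ i) := u0; have /colP/(_ i) := w0; rewrite col_mxEd !mxE.
  by case: (v _ _) => a b /= -> ->.
have := dotp_CauchySchwarz x s; have := dotp_CauchySchwarz x y.
have Xx : X2 p = sqnorm x by rewrite /X2 -sqnorm_xpart_rcoord.
rewrite Xx in ddh0 lt_lam *.
have := lamA s; have := lamA y; have := posdef_ge0 u pB; have := posdef_ge0 w pB.
have := sqnorm_ge0 s; have := sqnorm_ge0 y; have := sqnorm_ge0 u; have := sqnorm_ge0 w.
move: (sqnorm s) (sqnorm y) (sqnorm u) (sqnorm w) nz => S Y U W nz.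
move: (dotp x s ^+ 2) (dotp x y ^+ 2) => XS XY.
move: (sqnorm x) (dotp (A *m y) y) (dotp (A *m s) s) ddh0 lt_lam.
move: (dotp (B *m u) u) (dotp (B *m w) w).
move=> b1 b2 N a1 a2 ddh0 lt_lam W0 U0 Y0 S0 b20 b10 la1 la2 cs1 cs2.
have h1 := ler_wpM2l ddh0 cs1; have h2 := ler_wpM2l ddh0 cs2.
have gap : 0 < lam - dh N - 2 * N * ddh N by lra.
have h3 := mulr_ge0 (ltW gap) S0; have h4 := mulr_ge0 (ltW gap) Y0.
have [UW|UW] := ltP 0 (U + W); first by lra.
have SY : 0 < S + Y by lra.
have := mulr_gt0 gap SY; lra.
Qed.

(** The index is exactly k: a subspace on which the form is negative definite
    meets the space x = 0, of dimension 2n - k, trivially. *)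
Lemma morse_tau (delta : R) : posdef A -> posdef B -> 0 < delta ->
  dh 0 = delta -> ddh 0 = 0 -> morse_critical_point (tau A B h) 0 k.
Proof.
move=> pA pB d0 dh0 ddh0.
have X20 : X2 0 = 0 by rewrite /X2 rcoord0 mulmx0 dotp0l.
pose H := hessian (tau A B h) 0.
have xpart0 : xpart (0 : Cn) = 0.
  by apply/colP => j; rewrite !mxE.
have form x y u v (w := col_mx (col_mx x u) (col_mx y v)) : dotp (H *m w) w =
    2 * (dotp (A *m y) y + dotp (B *m v) v + sqnorm u) - 2 * delta * sqnorm x.
  by rewrite hessian_tau_form X20 dh0 ddh0 xpart0 dotp0l mulr0 mul0r subr0.
have HE : H = 2 *: Qmx - (2 * delta) *: Xmx.
  apply/matrixP => a b; rewrite /H (hessianE has_pderiv_tau has_pderiv_tau1) mxE.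
  rewrite tau2C /tau2 X20 dh0 ddh0 mul0r mulr0 addr0; move: Qmx Xmx => Q X.
  by rewrite !mxE; ring.
have symH : H^T = H by rewrite HE linearB !linearZ /= trmx_Qmx trmx_Xmx.
have split4 (w : 'cV[R]_(n + n)) : exists x u y v, w = col_mx (col_mx x u) (col_mx y v).
  exists (usubmx (usubmx w)), (dsubmx (usubmx w)).
  exists (usubmx (dsubmx w)), (dsubmx (dsubmx w)).
  by rewrite !vsubmxK.
have rowform (w : 'rV[R]_(n + n)) : (w *m H *m w^T) 0 0 = dotp (H *m w^T) w^T.
  by rewrite dotpC dotpE trmxK mulmxA.
have critical a : partial a (tau A B h) 0 = 0.
  rewrite (has_pderiv_partial (has_pderiv_tau a)) /tau1 rcoord0 !mulmx0.
  by rewrite !mxE !mulr0 subrr.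
split => //.
- by exists setT; split => //; [exact: openT|exact: C2_on_tau].
- rewrite -row_free_unit; apply: inj_row_free => w wH.
  have [x [u [y [v wE]]]] := split4 w^T.
  suff wT0 : w^T = 0 by rewrite -[w]trmxK wT0 trmx0.
  (* Reversing the sign of x makes all the terms of H(w, z) nonnegative. *)
  pose z := col_mx (col_mx (- x) u) (col_mx y v).
  have : dotp (H *m w^T) z = 0.
    by rewrite dotp_adj symH dotpE trmxK mulmxA [w *m H]wH mul0mx mxE.
  rewrite HE mulmxBl -!scalemxAl dotpDl dotpNl !dotpZl wE mul_Qmx mul_Xmx.
  rewrite /z !dotp_col_mx !dotp0l [dotp x _]dotpC dotpNl -/(sqnorm x) -/(sqnorm u) => e.
  have := posdef_ge0 y pA; have := posdef_ge0 v pB => v0 y0.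
  have := sqnorm_ge0 u; have := mulr_ge0 (ltW d0) (sqnorm_ge0 x) => x0 u0.
  have -> : x = 0.
    apply/eqP; rewrite -sqnorm_eq0 eq_le sqnorm_ge0 andbT -(pmulr_rle0 _ d0); lra.
  have -> : u = 0 by apply/eqP; rewrite -sqnorm_eq0 eq_le sqnorm_ge0 andbT; lra.
  have -> : y = 0 by apply/eqP/contraT => /pA; lra.
  have -> : v = 0 by apply/eqP/contraT => /pB; lra.
  by rewrite !col_mx0.
split.
- exists Xmx; last by rewrite /Xmx !rank_diag_block_mx mxrank1 !mxrank0 !addn0.
  move=> w /submxP[M wM] w0; rewrite rowform.
  have [x [u [y [v wE]]]] := split4 w^T.
  have : Xmx *m w^T = w^T.
    by rewrite wM trmx_mul trmx_Xmx mulmxA mul_Xmx_idem.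
  have {w0} : w^T != 0 by rewrite trmx_eq0.
  rewrite wE mul_Xmx => w0 /eq_col_mx[/eq_col_mx[_ u0] yv0].
  move: yv0; rewrite -col_mx0 => /eq_col_mx[y0 v0].
  rewrite form -u0 -y0 -v0 !mulmx0 /sqnorm !dotp0l -/(sqnorm x).
  have : 0 < sqnorm x.
    by rewrite sqnorm_gt0; apply: contraNneq w0 => ->; rewrite -u0 -y0 -v0 !col_mx0.
  by move=> /(mulr_gt0 d0); lra.
- move=> U nU; pose W := 1%:M - Xmx.
  have cap : (U :&: W = 0)%MS.
    apply/eqP; rewrite -submx0; apply/rV_subP => w.
    rewrite sub_capmx => /andP[wU /submxP[M wM]]; rewrite submx0.
    apply: contraT => /(nU w wU); rewrite rowform.
    have [x [u [y [v wE]]]] := split4 w^T.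
    have : Xmx *m w^T = 0.
      rewrite wM trmx_mul linearB /= trmx1 trmx_Xmx mulmxA mulmxBr mulmx1.
      by rewrite mul_Xmx_idem subrr mul0mx.
    rewrite wE mul_Xmx -!col_mx0 => /eq_col_mx[/eq_col_mx[x0 _] _].
    rewrite form x0 /sqnorm dotp0l -/(sqnorm u).
    have := posdef_ge0 y pA; have := posdef_ge0 v pB; have := sqnorm_ge0 u; lra.
  have rW : \rank W = (m + n)%N.
    rewrite (_ : W = block_mx (block_mx 0 0 0 1%:M) 0 0 1%:M); last first.
      rewrite /W /Xmx !scalar_mx_block !opp_block_mx !add_block_mx.
      by rewrite !(subrr, subr0, addr0).
    by rewrite !rank_diag_block_mx mxrank0 !mxrank1.
  have := mxrank_sum_cap U W; rewrite cap mxrank0 addn0 rW => e.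
  rewrite -(leq_add2r (m + n)) -e [leqRHS]addnA.
  exact: rank_leq_row.
Qed.

End Model.

(** * Existence of h and the properties of Q - h(|x|^2) *)

Theorem proposition4p1 (R : realType) (n k : nat)
    (hn : (1 <= n)%N) (hk : (1 <= k <= n)%N)
    (A : 'M[R]_k) (B : 'M[R]_(n - k))
    (symA : A^T = A) (symB : B^T = B)
    (hA : posdef (A - 1%:M)) (hB : posdef B)
    (r eps : R) (hr : 0 < r) (heps : 0 < eps) :
  exists (c0 R0 delta : R) (h : R -> R),
    [/\ r < c0, c0 < R0 & 0 < delta] /\
    [/\ forall t, 0 <= t -> 0 <= h t,
        smooth_on [set t : R | 0 <= t] h,
        forall s t, 0 <= s -> s < t -> h s < h t &
        @convex_function R R^o [set t : R | 0 <= t] h] /\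
    strongly_psh [set: 'cV[R[i]]_(k + (n - k))] (tau A B h) /\
    morse_critical_point (tau A B h) 0 k /\
    [/\ forall p : 'cV[R[i]]_(k + (n - k)), sqnorm (xpart p) <= r ->
          tau A B h p = Qfun A B p - delta * sqnorm (xpart p),
        forall p : 'cV[R[i]]_(k + (n - k)), R0 <= sqnorm (xpart p) ->
          tau A B h p = rho A B p + c0,
        [set p | rho A B p <= - c0] `|` Lambda R k (n - k)
          `<=` [set p | tau A B h p <= 0] &
        [set p | tau A B h p <= 0]
          `<=` [set p | rho A B p < - r] `|` [set p | Qfun A B p < eps]].
Proof.
have [mu mu0 muA] : exists2 mu, 0 < mu &
    forall u, mu * sqnorm u <= dotp ((A - 1%:M) *m u) u.
  by apply: posdef_coercive => //; rewrite linearB /= symA trmx1.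
have A1 u : dotp (A *m u) u = dotp ((A - 1%:M) *m u) u + sqnorm u.
  by rewrite mulmxBl mul1mx dotpDl dotpNl subrK.
have lamA u : (1 + mu) * sqnorm u <= dotp (A *m u) u.
  by rewrite A1; have := muA u; lra.
have pA : posdef A.
  by move=> u u0; rewrite A1; have := hA u u0; have := sqnorm_ge0 u; lra.
have lam1 : 1 < 1 + mu by lra.
have [c0 [R0 [delta [h [dh [ddh]]]]]] := profile hr heps lam1.
move=> [[rc0 c0R d0] [[Dh' Ddh' cddh sh] [[dh01 ddh0 lt_lam] [hlo hhi hpos hsmall]]]].
have Dh (t : R) : 0 <= t -> is_derive t 1 h (dh t) by move=> t0; apply: Dh'; lra.
have Ddh (t : R) : 0 <= t -> is_derive t 1 dh (ddh t) by move=> t0; apply: Ddh'; lra.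
have [_ dh0 ddh00] : [/\ h 0 = delta * 0, dh 0 = delta & ddh 0 = 0].
  by apply: hlo; lra.
have x2_ge0 (p : 'cV[R[i]]_(k + (n - k))) := sqnorm_ge0 (xpart p).
exists c0, R0, delta, h; split=> //; split; last split; last split.
- split=> //; first by move=> t /hpos[].
    by apply: derive_increasing Dh _ => t /dh01/andP[].
  exact: derive_convex Dh Ddh ddh0.
- split; first exact: (C2_on_tau symA symB Dh Ddh cddh).
  move=> p _ v; apply: (levi_tau_gt0 symA symB Dh Ddh lamA hB (ddh0 _)).
  by apply: lt_lam; rewrite -sqnorm_xpart_rcoord.
- exact: (morse_tau symA symB Dh Ddh cddh pA hB d0 dh0 ddh00).
split.
- move=> p pr; have xr : 0 <= sqnorm (xpart p) <= r by rewrite x2_ge0.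
  by rewrite /tau; have [-> _ _] := hlo _ xr.
- by move=> p /hhi; rewrite /tau /rho => ->; ring.
- move=> p [|[x _ <-]] /=.
    by rewrite /rho /tau; have [_] := hpos _ (x2_ge0 p); lra.
  rewrite /tau; set q := col_mx _ _.
  have -> : Qfun A B q = 0.
    have y0 : ypart q = 0 by apply/colP => j; rewrite /ypart /q col_mxKu !mxE.
    have u0 : upart q = 0 by apply/colP => j; rewrite /upart /q col_mxKd !mxE.
    have v0 : vpart q = 0 by apply/colP => j; rewrite /vpart /q col_mxKd !mxE.
    by rewrite /Qfun y0 u0 v0 !mulmx0 /sqnorm !dotp0l !addr0.
  by have [] := hpos _ (x2_ge0 q); lra.
- move=> p /=; rewrite /tau /rho => tau0.
  by have [?|?] := hsmall _ (x2_ge0 p); [left|right] => /=; lra.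
Qed.
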